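(* Let $\mathbf{n} \in \mathbb{Z}^k_{>0}$, $\mathbf{s} \in \mathbb{R}^k$, $0 < \lambda < \frac12$ and $\gamma \ge 1$. If the zonotope $\mathsf{Z}_{\lambda,\gamma}(\mathbf{n},\mathbf{s}) = \mathbf{s} + [\lambda, 1-\lambda]^k + [0,\gamma]\,\mathbf{n}$ is hollow, then $\mathbf{m}\cdot\mathbf{n} = 0$ for some $\mathbf{m} \in \mathbb{Z}^k$ with $0 < \|\mathbf{m}\|_1 \le \frac{\operatorname{flt}(k)}{1-2\lambda}$.
   Context: Here $k$ is a positive integer, $\mathbb{Z}^k_{>0}$ is the set of vectors of $k$ positive integers, and $\gamma$ is real. For $\mathbf{n} \in \mathbb{Z}^k_{>0}$ and $\mathbf{s} \in \mathbb{R}^k$, $\mathsf{Z}_{\lambda,\gamma}(\mathbf{n},\mathbf{s}) := \mathbf{s} + [\lambda,1-\lambda]^k + [0,\gamma]\,\mathbf{n}$ is a Minkowski sum, where $[0,\gamma]\,\mathbf{n} = \{ t\mathbf{n} : 0 \le t \le \gamma\}$. For $\mathbf{m} \in \mathbb{Z}^k$, $\|\mathbf{m}\|_1 := |m_1| + \dots + |m_k|$. The lattice width of a convex body $C \subset \mathbb{R}^k$ is $\operatorname{width}(C) := \min_{\mathbf{m} \in \mathbb{Z}^k \setminus \{\mathbf{0}\}} \max_{\mathbf{a},\mathbf{b} \in C} \mathbf{m}\cdot(\mathbf{a}-\mathbf{b})$. The body $C$ is hollow if it contains no integer points (points of $\mathbb{Z}^k$) in its interior. The flatness constant $\operatorname{flt}(k)$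 is the minimal number such that every hollow convex body $C \subset \mathbb{R}^k$ has $\operatorname{width}(C) \le \operatorname{flt}(k)$; its existence (finiteness) is Khinchin's flatness theorem. *)

(* Defs.v *)
From HB Require Import structures.
From mathcomp Require Import all_boot all_order all_algebra.
From mathcomp Require Import all_classical all_reals all_analysis.

Set Implicit Arguments.
Unset Strict Implicit.
Unset Printing Implicit Defensive.

Import Order.TTheory GRing.Theory Num.Theory.
Import numFieldNormedType.Exports.

Local Open Scope classical_set_scope.
Local Open Scope ring_scope.

Definition dotp (T : pzRingType) (k : nat) (u v : 'rV[T]_k) : T :=
  \sum_(i < k) u 0 i * v 0 i.

Definition int_vec (R : realType) (k : nat) (m : 'rV[int]_k) : 'rV[R]_k :=
  map_mx intr m.

Definition norm1 (k : nat) (m : 'rV[int]_k) : int := \sum_(i < k) `|m 0 i|.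

Definition minkowski_sum (V : zmodType) (A B : set V) : set V :=
  [set a + b | a in A & b in B].

Definition cube (R : realType) (k : nat) (a b : R) : set 'rV[R]_k :=
  [set x | forall i, a <= x 0 i <= b].

Definition segment0 (R : realType) (k : nat) (g : R) (v : 'rV[R]_k) :
  set 'rV[R]_k := [set t *: v | t in `[0, g]].

Definition zonotope (R : realType) (k : nat) (lambda gamma : R)
    (n : 'rV[int]_k) (s : 'rV[R]_k) : set 'rV[R]_k :=
  minkowski_sum (minkowski_sum [set s] (cube lambda (1 - lambda)))
                (segment0 gamma (int_vec R n)).

Definition convex_body (R : realType) (k : nat) (C : set 'rV[R]_k) : Prop :=
  [/\ convex_set C, compact C & C° !=set0].

Definition hollow (R : realType) (k : nat) (C : set 'rV[R]_k) : Prop :=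
  forall z : 'rV[int]_k, ~ C° (int_vec R z).

(* For a convex body and k > 0 the supremum is a maximum, by compactness, and
   the infimum is a minimum: the body contains a ball, so only finitely many m
   have width below a given bound. *)
Definition width (R : realType) (k : nat) (C : set 'rV[R]_k) : R :=
  inf [set sup [set dotp (int_vec R m) (a - b) | a in C & b in C]
      | m in [set m : 'rV[int]_k | m != 0]].

(* The least real number bounding the width of every hollow convex body. It is
   taken in the extended reals so that the definition does not presuppose
   Khinchin's flatness theorem, which says precisely that it is finite. *)
Definition flt (R : realType) (k : nat) : \bar R :=
  ereal_inf (EFin @` [set c : R | forall C : set 'rV[R]_k,
    convex_body C -> hollow C -> width C <= c]).

(* Main.v *)
Require Import Defs.
From HB Require Import structures.
From mathcomp Require Import all_boot all_order all_algebra.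
From mathcomp Require Import all_classical all_reals all_analysis.
From mathcomp Require Import lra ring.

(** Translating by the integer vector n preserves the integer points, so an
integer point inside a long zonotope Z_N = s + [lambda, 1 - lambda]^k + [0, N] n
can be pushed back along n into Z_1.  As soon as Z_gamma is hollow for one
gamma >= 1, every Z_N is therefore a hollow convex body
([hollow_zonotope], [convex_body_zonotope]), and its width is at most flt(k)
([width_le_flt]).  On the other hand the extent of Z_N in direction m is exactly
(1 - 2 lambda) |m|_1 + N |m.n| ([sup_dotp_zonotope]).  For N large, a bound on
this extent that is independent of N forces the integer m.n to vanish, and what
remains is (1 - 2 lambda) |m|_1 <= flt(k).

The width is an infimum, so a direction m is only obtained with extent less than
any given number exceeding flt(k).  That suffices because |m|_1 is an integer:
the bound |m|_1 < floor (flt(k) / (1 - 2 lambda)) + 1 is as good as the desired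
one.

The argument above supposes flt(k) finite.  If it were infinite, only the
existence of a nonzero m orthogonal to n would be claimed: it is elementary for
k >= 2 ([exists_orthogonal]), while for k = 1 no such m exists, but then Z_gamma
is an interval of length greater than 1 and is never hollow
([not_hollow_zonotope1]). *)

Set Implicit Arguments.
Unset Strict Implicit.
Unset Printing Implicit Defensive.

Import Order.TTheory GRing.Theory Num.Theory.
Import numFieldNormedType.Exports.

Local Open Scope classical_set_scope.
Local Open Scope ring_scope.

(** * Points and interior points of the zonotope *)

Lemma zonotopeP (R : realType) (k : nat) (n : 'rV[int]_k) (s : 'rV[R]_k)
    (lambda g : R) (x : 'rV[R]_k) :
  zonotope lambda g n s x <-> exists t : R, 0 <= t <= g /\
    forall i, lambda <= x 0 i - s 0 i - t * (n 0 i)%:~R <= 1 - lambda.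
Proof.
split=> [[_ [_ -> [c hc <-]] [_ [t ht <-] <-]]|[t [ht hx]]].
  exists t; split; first by move: ht; rewrite /= in_itv.
  move=> i; have := hc i; rewrite !mxE.
  by rewrite (_ : s 0 i + c 0 i + _ - _ - _ = c 0 i) //; ring.
exists (x - t *: int_vec R n); last first.
  exists (t *: int_vec R n); last by rewrite subrK.
  by exists t => //=; rewrite in_itv.
exists s => //; exists (x - t *: int_vec R n - s); last by rewrite addrC subrK.
move=> i; have := hx i; rewrite !mxE.
by rewrite (_ : x 0 i - s 0 i - _ = x 0 i - t * (n 0 i)%:~R - s 0 i) //; ring.
Qed.

(** Fixing t leaves an open box inside the zonotope, which gives one direction.
Conversely an interior point x can be moved slightly away from the centre p
of the zonotope to x + e (x - p) and stays inside; since x is a proper convex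
combination of this point and of p, whose box coordinate is 1/2, its own box
coordinates are strictly between lambda and 1 - lambda.  No strictness is
claimed on t: only integer translates of x along n matter later. *)
Lemma interior_zonotopeP (R : realType) (k : nat) (n : 'rV[int]_k)
    (s : 'rV[R]_k) (lambda g : R) (x : 'rV[R]_k) :
    lambda < 1 / 2 -> 0 <= g ->
  (zonotope lambda g n s)° x <-> exists t : R, 0 <= t <= g /\
    forall i, lambda < x 0 i - s 0 i - t * (n 0 i)%:~R < 1 - lambda.
Proof.
move=> ll g0; split => [intx|[t [ht hx]]].
  pose p : 'rV[R]_k :=
    s + const_mx (1 / 2) + (g / 2) *: int_vec R n.
  have cvx : (fun e : R => x + e *: (x - p)) @ (0 : R) --> x.
    rewrite -[X in _ --> X]addr0 -(scale0r (x - p)).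
    by apply: cvgD; [exact: cvg_cst|apply: cvgZr_tmp; exact: cvg_id].
  have nearZ : \forall e \near 0^'+,
      zonotope lambda g n s (x + e *: (x - p)).
    by apply: cvg_within; exact: cvx.
  have [e [e0 /zonotopeP[t [/andP[t0 tg] ht]]]] :
      exists e : R, 0 < e /\ zonotope lambda g n s (x + e *: (x - p)).
    near (0 : R)^'+ => e; exists e; split; near: e; first exact: nbhs_right_gt.
    exact: nearZ.
  have e1 : 0 < 1 + e by lra.
  (* the combination of the parameters t of x + e (x - p) and g / 2 of p, with
     weights 1 / (1 + e) and e / (1 + e) *)
  exists ((t + e * (g / 2)) / (1 + e)); split.
    rewrite divr_ge0 ?ler_pdivrMr //=; last by lra.
      by nra.
    by rewrite addr_ge0 // mulr_ge0 ?divr_ge0 // ltW.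
  move=> i; have /andP[lo hi] := ht i; rewrite !mxE in lo hi.
  have -> : x 0 i - s 0 i - (t + e * (g / 2)) / (1 + e) * (n 0 i)%:~R =
    ((x 0 i + e * (x 0 i - (s 0 i + 1 / 2 + g / 2 * (n 0 i)%:~R)))
      - s 0 i - t * (n 0 i)%:~R + e * (1 / 2)) / (1 + e).
    by field; lra.
  move: lo hi; set u := _ - s 0 i - _ => lo hi.
  by rewrite ltr_pdivlMr // ltr_pdivrMr //; apply/andP; split; nra.
exists (fun _ j => `](lambda + s 0 j + t * (n 0 j)%:~R),
    (1 - lambda + s 0 j + t * (n 0 j)%:~R)[%classic).
  move=> i j; rewrite ord1.
  apply: open_nbhs_nbhs; split; first exact: interval_open.
  by rewrite /= in_itv /=; have := hx j; lra.
move=> y hy; apply/zonotopeP; exists t; split=> // i.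
by have := hy 0 i; rewrite /= in_itv /=; lra.
Unshelve. all: by end_near. Qed.

(** * The zonotope as a convex body *)

Lemma minkowski_sum_compact (K : numFieldType) (V : normedModType K)
    (A B : set V) :
  compact A -> compact B -> compact (minkowski_sum A B).
Proof.
move=> cA cB.
have -> : minkowski_sum A B = [set z.1 + z.2 | z in A `*` B].
  apply/seteqP; split=> [_ [a Aa [b Bb <-]]|_ [[a b] [Aa Bb] <-]].
    by exists (a, b).
  by exists a => //; exists b.
apply: continuous_compact; last exact: compact_setX.
by apply: continuous_subspaceT; exact: add_continuous.
Qed.

Lemma compact_zonotope (R : realType) (k : nat) (n : 'rV[int]_k)
  (s : 'rV[R]_k) (lambda g : R) : compact (zonotope lambda g n s).
Proof.
apply: minkowski_sum_compact; first apply: minkowski_sum_compact.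
- exact: compact_set1.
- have -> : cube lambda (1 - lambda) =
     [set v : 'rV[R]_k | forall i, `[lambda, 1 - lambda]%classic (v ord0 i)].
    by apply/seteqP; split=> v hv i; have := hv i; rewrite /= in_itv.
  apply: (@rV_compact R k (fun=> `[lambda, 1 - lambda]%classic)) => i.
  exact: segment_compact.
- apply: continuous_compact; last exact: segment_compact.
  apply: continuous_subspaceT => t; apply: cvgZr_tmp; exact: cvg_id.
Qed.

Lemma convex_zonotope (R : realType) (k : nat) (n : 'rV[int]_k)
  (s : 'rV[R]_k) (lambda g : R) : convex_set (zonotope lambda g n s).
Proof.
move=> x y p; rewrite !inE => /zonotopeP[t [ht hx]] /zonotopeP[u [hu hy]].
apply/zonotopeP; exists (p%:num * t + (1 - p%:num) * u).
have p0 : 0 <= p%:num by [].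
have p1 : p%:num <= 1 by [].
have convE : conv p x y =
  p%:num *: (x : 'rV[R]_k) + (1 - p%:num) *: (y : 'rV[R]_k) by [].
rewrite convE; move: (p%:num) p0 p1 => {convE}q q0 q1; split; first by nra.
move=> i; rewrite !mxE; have := hx i; have := hy i.
rewrite (_ : q * x 0 i + (1 - q) * y 0 i - s 0 i - (q * t + (1 - q) * u) * _ =
  q * (x 0 i - s 0 i - t * (n 0 i)%:~R) +
  (1 - q) * (y 0 i - s 0 i - u * (n 0 i)%:~R)); last by ring.
set a := x 0 i - _ - _; set b := y 0 i - _ - _.
by move=> /andP[? ?] /andP[? ?]; apply/andP; split; nra.
Qed.

Lemma convex_body_zonotope (R : realType) (k : nat) (n : 'rV[int]_k)
    (s : 'rV[R]_k) (lambda g : R) :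
  lambda < 1 / 2 -> 0 <= g -> convex_body (zonotope lambda g n s).
Proof.
move=> ll g0; split; [exact: convex_zonotope|exact: compact_zonotope|].
exists (s + const_mx (1 / 2)); apply/interior_zonotopeP => //.
by exists 0; split=> [|i]; rewrite ?lexx // !mxE; lra.
Qed.

(** * Elongating the zonotope along n *)

(** Subtract floor t copies of n from an integer point with parameter t
along n: it stays integer and its parameter becomes the
fractional part of t, which is less than 1, hence admissible for g. *)
Lemma hollow_zonotope (R : realType) (k : nat) (n : 'rV[int]_k)
    (s : 'rV[R]_k) (lambda g h : R) : lambda < 1 / 2 -> 1 <= g -> 0 <= h ->
  hollow (zonotope lambda g n s) -> hollow (zonotope lambda h n s).
Proof.
move=> ll g1 h0 hol z /interior_zonotopeP[]// t [_ ht].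
apply: (hol (z - Num.floor t *: n)); apply/interior_zonotopeP => //; first lra.
exists (t - (Num.floor t)%:~R); split.
  by have := floor_itv t; rewrite intrD; lra.
move=> i; have := ht i; rewrite !mxE rmorphB rmorphM /=.
set a := _ - _ - _; set b := _ - _ - _ => hi.
by rewrite (_ : b = a) // /a /b; ring.
Qed.

(** * Extent of the zonotope in an integer direction *)

(** Holds for arbitrary t and u; it is meant for the parameters along n of the
points a and b, the parentheses being then the box coordinates.  The two summands
are then bounded, and maximized, separately. *)
Lemma dotpB_generators (R : realType) (k : nat) (m n : 'rV[int]_k)
    (s a b : 'rV[R]_k) (t u : R) :
  dotp (int_vec R m) (a - b) =
    \sum_(i < k) (m 0 i)%:~R * ((a 0 i - s 0 i - t * (n 0 i)%:~R) -
                               (b 0 i - s 0 i - u * (n 0 i)%:~R)) +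
    (t - u) * (dotp m n)%:~R.
Proof.
rewrite /dotp rmorph_sum mulr_sumr -big_split /=.
by apply: eq_bigr => i _; rewrite !mxE rmorphM /=; ring.
Qed.

(** The extent is a sum over the generators of the zonotope: each edge of the box
contributes (1 - 2 lambda) |m_i| and the edge g n contributes g |m.n|.  It is
reached at a pair of opposite vertices chosen according to the signs of the
m_i and of m.n. *)
Lemma sup_dotp_zonotope (R : realType) (k : nat) (n : 'rV[int]_k)
    (s : 'rV[R]_k) (lambda g : R) (m : 'rV[int]_k) :
    lambda < 1 / 2 -> 0 <= g ->
  sup [set dotp (int_vec R m) (a - b)
      | a in zonotope lambda g n s & b in zonotope lambda g n s] =
  (1 - 2 * lambda) * (norm1 m)%:~R + g * `|(dotp m n)%:~R|.
Proof.
move=> ll g0; set E := [set _ | _ in _ & _ in _]; set v := RHS.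
have ubE : ubound E v.
  move=> _ [a /zonotopeP[t [ht ha]] [b /zonotopeP[u [hu hb]] <-]].
  rewrite (dotpB_generators m n s a b t u) /v lerD //.
    rewrite /norm1 rmorph_sum mulr_sumr /= ler_sum // => i _.
    rewrite mulrC (le_trans (ler_norm _)) // normrM intr_norm ler_wpM2r //.
    by rewrite ler_norml; have := ha i; have := hb i; lra.
  rewrite (le_trans (ler_norm _)) // normrM ler_wpM2r //.
  by rewrite ler_norml; lra.
have Ev : E v.
  (* e = true is the vertex maximizing m, e = false the opposite one *)
  pose vertex (e : bool) : 'rV[R]_k :=
    s + (if (0 <= dotp m n) == e then g else 0) *: int_vec R n +
    \row_i (if (0 <= m 0 i) == e then 1 - lambda else lambda).
  have vertexE e i : vertex e 0 i - s 0 i -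
      (if (0 <= dotp m n) == e then g else 0) * (n 0 i)%:~R =
      if (0 <= m 0 i) == e then 1 - lambda else lambda.
    by rewrite !mxE; ring.
  have vertexZ e : zonotope lambda g n s (vertex e).
    apply/zonotopeP; exists (if (0 <= dotp m n) == e then g else 0).
    split; first by case: ifP; rewrite g0 lexx.
    by move=> i; rewrite vertexE; case: ifP; lra.
  exists (vertex true) => //; exists (vertex false) => //.
  rewrite (dotpB_generators m n s _ _
    (if (0 <= dotp m n) == true then g else 0)
    (if (0 <= dotp m n) == false then g else 0)) /v; congr (_ + _).
    rewrite /norm1 rmorph_sum mulr_sumr /=; apply: eq_bigr => i _.
    rewrite !vertexE intr_norm.
    by case: (lerP 0 (m 0 i)) => hm /=;
      [rewrite ger0_norm ?ler0z //|rewrite ltr0_norm ?ltrz0 //]; ring.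
  by case: (lerP 0 (dotp m n)) => hm /=;
      [rewrite ger0_norm ?ler0z //|rewrite ltr0_norm ?ltrz0 //]; ring.
apply/le_anti/andP; split; first by apply: ge_sup => //; exists v.
by apply: ub_le_sup => //; exists v.
Qed.

(** * Widths and orthogonal directions *)

Lemma width_le_flt (R : realType) (k : nat) (C : set 'rV[R]_k) :
  convex_body C -> hollow C -> ((width C)%:E <= flt R k)%E.
Proof.
move=> cC hC; apply: le_ereal_inf_tmp => _ [c hc <-].
by rewrite lee_fin; exact: hc.
Qed.

(** The interior is an open interval of length 1 - 2 lambda + g n_0 > 1 starting
at s_0 + lambda, so it contains the first integer after its left end. *)
Lemma not_hollow_zonotope1 (R : realType) (n : 'rV[int]_1)
    (s : 'rV[R]_1) (lambda g : R) : 0 < lambda -> lambda < 1 / 2 -> 1 <= g ->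
  0 < n 0 0 -> ~ hollow (zonotope lambda g n s).
Proof.
move=> l0 ll g1 n0 /(_ (const_mx (Num.floor (s 0 0 + lambda) + 1))).
apply; apply/interior_zonotopeP => //; first lra.
have := floor_itv (s 0 0 + lambda); set f := Num.floor _; rewrite intrD => hf.
have n1 : 1 <= (n 0 0)%:~R :> R by rewrite ler1z -gtz0_ge1.
(* The distance u, in ]0, 1], of this integer to the left end is shared between
   the box and n: the part u (1 - 2 lambda) / 2 is strictly less than the side
   of the box, and the rest u (1 + 2 lambda) / 2 is at most 1 <= n_0. *)
pose u : R := f%:~R + 1 - s 0 0 - lambda.
exists (u * ((1 + 2 * lambda) / 2) / (n 0 0)%:~R).
have nn : (n 0 0)%:~R != 0 :> R by rewrite lt0r_neq0 // ltr0z.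
split.
  rewrite divr_ge0 ?ler_pdivrMr ?ltr0z //=; rewrite /u; nra.
move=> i; rewrite (ord1 i) divfK // !mxE intrD -/u; rewrite /u; nra.
Qed.

Lemma norm1_gt0 (k : nat) (m : 'rV[int]_k) : m != 0 -> 0 < norm1 m.
Proof.
move=> m0; rewrite lt0r sumr_ge0 ?andbT //.
apply: contra m0; rewrite psumr_eq0 // => /allP h.
apply/eqP/rowP => i; rewrite mxE; apply/eqP.
by rewrite -normr_eq0; apply: h; rewrite mem_index_enum.
Qed.

Lemma exists_orthogonal (k : nat) (n : 'rV[int]_k.+2) :
  exists2 m : 'rV[int]_k.+2, m != 0 & dotp m n = 0.
Proof.
pose v a b : 'rV[int]_k.+2 := \row_i [eta (fun=> 0) with 0 |-> a, 1 |-> b] i.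
have vE a b : dotp (v a b) n = a * n 0 0 + b * n 0 1.
  rewrite /dotp 2!big_ord_recl big1 => [|i _]; rewrite !mxE //= ?mul0r //.
  by rewrite addr0 (_ : lift _ _ = 1) //; apply/val_inj.
have [n0|n0] := eqVneq (n 0 0) 0.
  exists (v 1 0); last by rewrite vE n0 mulr0 mul0r.
  by apply/eqP => /rowP/(_ 0); rewrite !mxE.
exists (v (n 0 1) (- n 0 0)); last by rewrite vE; ring.
by apply/eqP => /rowP/(_ 1); rewrite !mxE /=; apply/eqP; rewrite oppr_eq0.
Qed.

(** * The orthogonal integer vector *)

Theorem theorem3p2 (R : realType) (k : nat) (k_gt0 : (0 < k)%N)
    (n : 'rV[int]_k) (n_gt0 : forall i, 0 < n 0 i) (s : 'rV[R]_k)
    (lambda gamma : R) (lambda_gt0 : 0 < lambda) (lambda_lt : lambda < 1 / 2)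
    (gamma_ge1 : 1 <= gamma) :
  hollow (zonotope lambda gamma n s) ->
  exists m : 'rV[int]_k,
    [/\ dotp m n = 0, 0 < norm1 m &
        (((norm1 m)%:~R : R)%:E <= flt R k / (1 - 2 * lambda)%:E)%E].
Proof.
move=> hol; pose d : R := 1 - 2 * lambda.
have d0 : 0 < d by rewrite /d; lra.
rewrite inver gt_eqF -/d //.
have width_Z g : 0 <= g -> ((width (zonotope lambda g n s))%:E <= flt R k)%E.
  move=> g0; apply: width_le_flt; first exact: convex_body_zonotope.
  exact: hollow_zonotope hol.
case: (flt R k) width_Z => [r| |] width_Z; last by have := width_Z 0 (lexx _).
- have {}width_Z g : 0 <= g -> width (zonotope lambda g n s) <= r.
    by move=> /width_Z; rewrite lee_fin.
  (* B is the least multiple of d by an integer that exceeds r, so for an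
     integer j, d j < B means that j <= r / d; the length `|B| makes any nonzero
     integer value of m.n contribute at least B to the extent. *)
  pose B : R := (Num.floor (r / d) + 1)%:~R * d.
  have rB : r < B by rewrite -ltr_pdivrMr // floorD1_gt.
  have [] := inf_lt _ (le_lt_trans (width_Z `|B| (normr_ge0 _)) rB).
    exists (sup [set dotp (int_vec R (const_mx 1)) (a - b)
      | a in zonotope lambda `|B| n s & b in zonotope lambda `|B| n s]).
    exists (const_mx 1) => //=.
    by apply/eqP => /rowP/(_ (Ordinal k_gt0)); rewrite !mxE.
  move=> _ [m m0 <-]; rewrite sup_dotp_zonotope // -/d => mB.
  have m_gt0 := norm1_gt0 m0.
  have dm_gt0 : 0 < d * (norm1 m)%:~R by rewrite mulr_gt0 // ltr0z.
  have mn0 : dotp m n = 0.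
    apply/eqP/negPn/negP => mn0.
    have mn1 : 1 <= `|(dotp m n)%:~R| :> R.
      by rewrite -intr_norm ler1z -gtz0_ge1 normr_gt0.
    have BB : `|B| <= `|B| * `|(dotp m n)%:~R| by rewrite ler_peMr.
    by have := ler_norm B; lra.
  exists m; split=> //.
  rewrite -EFinM lee_fin -floor_ge_int -ltzD1 -(ltr_int R) -(ltr_pM2r d0).
  by move: mB; rewrite mn0 normr0 mulr0 addr0 mulrC.
- rewrite gt0_mulye ?lte_fin ?invr_gt0 //.
  case: k => [|[|k]] in k_gt0 n n_gt0 s hol {width_Z} *; first by [].
    by case: (not_hollow_zonotope1 lambda_gt0 lambda_lt gamma_ge1 (n_gt0 0) hol).
  have [m m0 mn0] := exists_orthogonal n.
  by exists m; split; rewrite ?leey ?norm1_gt0.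
Qed.
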